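(* Let $L$ be a frame. Then $L\textbf{-Top}_{0}$, the full subcategory of $T_0$-$L$-topological spaces, is the epireflective hull of the Sierpinski $L$-topological space $L_{S}$ in the category $L\textbf{-Top}$ of $L$-topological spaces.
   Context: A frame is a complete lattice $L$ satisfying $a\wedge\bigvee_i b_i=\bigvee_i(a\wedge b_i)$; its least and largest elements are $0,1$. For a set $X$, $L^X$ (all maps $X\to L$) carries the pointwise order. An $L$-topology on $X$ is a subset $\tau\subseteq L^X$ closed under arbitrary suprema and finite infima (in particular containing the constant maps $\bar 0$ and $\bar 1$); $(X,\tau)$ is then an $L$-topological space. A map $f:(X,\tau)\to(Y,\delta)$ is continuous if $f^{\leftarrow}(\nu):=\nu\circ f\in\tau$ for every $\nu\in\delta$. $L\textbf{-Top}$ is the category of $L$-topological spaces and continuous maps. For $\zeta\subseteq L^X$, $\langle\zeta\rangle$ is the $L$-topology consisting of all suprema of finite infima of members of $\zeta$. The Sierpinski $L$-topological space is $L_S=(L,\langle\{\mathrm{id}_L\}\rangle)$. $(X,\tau)$ is $T_0$ if for all distinct $x,y\in X$ there is $\mu\in\tau$ with $\mu(x)\ne\mu(y)$. $L\textbf{-Top}_0$ is the full subcategory of $L\textbf{-Top}$ of $T_0$ spaces. All subcategories are full and replete (closed under isomorphism). A subcategory $\mathscr R$ of $\mathscr C$ is epireflective in $\mathscr C$ if for each $\mathscr C$-object $X$ there is a $\mathscr C$-epimorphism $r_X:X\to RX$ with $RX\in\mathscr R$ such that each $\mathscr C$-morphism $f:X\to Y$ with $Y\in\mathscr R$ factors as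 $f=f^*\circ r_X$ for a unique morphism $f^*:RX\to Y$. The epireflective hull of an object $E$ in $\mathscr C$ is the smallest epireflective subcategory of $\mathscr C$ containing $E$. *)

(* Defs.v *)
From HB Require Import structures.
From mathcomp Require Import all_boot all_order.
From mathcomp Require Import boolp classical_sets functions cardinality.
Set Implicit Arguments.
Unset Strict Implicit.
Unset Printing Implicit Defensive.
Import Order.LTheory.
Local Open Scope classical_set_scope.

HB.mixin Record isFrame (d : Order.disp_t) L of Order.Lattice d L := {
  frame_sup : forall A : set L, supremums A !=set0 ;
  frame_inf : forall A : set L, infimums A !=set0 ;
  frame_distr : forall (a : L) (A : set L) (s : L), supremums A s ->
    supremums [set (a `&` b)%O | b in A] (a `&` s)%O
}.

#[short(type="frameType")]
HB.structure Definition Frame (d : Order.disp_t) :=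
  { L of isFrame d L & Order.Lattice d L }.

(* On [X -> L] the order is the pointwise one provided by [boolp]. For [S] (or
   [F]) empty, the two closure conditions say that the constant maps 0 and 1
   are open. *)
Definition is_ltopology (d : Order.disp_t) (L : frameType d) (X : Type)
    (tau : set (X -> L)) : Prop :=
  (forall (S : set (X -> L)) (mu : X -> L),
     S `<=` tau -> supremums S mu -> tau mu) /\
  (forall (F : set (X -> L)) (mu : X -> L),
     F `<=` tau -> finite_set F -> infimums F mu -> tau mu).

Definition finite_infima (d : Order.disp_t) (L : frameType d) (X : Type)
    (zeta : set (X -> L)) : set (X -> L) :=
  [set nu | exists F : set (X -> L),
     [/\ F `<=` zeta, finite_set F & infimums F nu]].

Definition generated_ltopology (d : Order.disp_t) (L : frameType d) (X : Type)
    (zeta : set (X -> L)) : set (X -> L) :=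
  [set mu | exists S : set (X -> L),
     S `<=` finite_infima zeta /\ supremums S mu].

Section GeneratedTopology.
Variables (d : Order.disp_t) (L : frameType d) (X : Type).
Implicit Types (S F zeta : set (X -> L)) (mu nu : X -> L).

Let ev S (x : X) : set L := [set nu x | nu in S].

Lemma fct_supremumsP S mu :
  supremums S mu <-> forall x, supremums (ev S x) (mu x).
Proof.
split=> [[ub lub] x|H]; last first.
  split=> [nu Snu|g gub]; apply/lefP => x.
    by have [+ _] := H x; apply; exists nu.
  have [_ +] := H x; apply=> _ [nu Snu <-].
  by have /lefP := gub _ Snu; apply.
have [s Hs] := choice (fun y => frame_sup (ev S y)).
suff -> : mu = s by exact: Hs.
apply/le_anti/andP; split.
  apply: lub => nu Snu; apply/lefP => y.
  by have [+ _] := Hs y; apply; exists nu.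
apply/lefP => y; have [_ +] := Hs y; apply=> _ [nu Snu <-].
by have /lefP := ub _ Snu; apply.
Qed.

Lemma fct_infimums_ex S : infimums S !=set0.
Proof.
have [s Hs] := choice (fun y => frame_inf (ev S y)).
exists s; split=> [nu Snu|g glb]; apply/lefP => y.
  by have [+ _] := Hs y; apply; exists nu.
have [_ +] := Hs y; apply=> _ [nu Snu <-].
by have /lefP := glb _ Snu; apply.
Qed.

Lemma fct_meet_supremums mu S nu : supremums S nu ->
  supremums [set (mu `&` k)%O | k in S] (mu `&` nu)%O.
Proof.
move=> /fct_supremumsP H; apply/fct_supremumsP => x.
rewrite (_ : ev _ x = [set (mu x `&` b)%O | b in ev S x]).
  exact: frame_distr.
apply/seteqP; split=> [_ [_ [k Sk <-] <-]|_ [_ [k Sk <-] <-]].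
  by exists (k x) => //; exists k.
by exists (mu `&` k)%O => //; exists k.
Qed.

Lemma infimums_meet F mu nu : infimums F nu ->
  infimums (mu |` F) (mu `&` nu)%O.
Proof.
move=> [lb glb]; split=> [k [->|Fk]|k kb]; first exact: leIl.
  exact: le_trans (leIr _ _) (lb _ Fk).
by rewrite lexI kb ?glb //; [move=> h Fh; apply: kb; right|left].
Qed.

Lemma finite_infima_meet zeta mu nu : finite_infima zeta mu ->
  finite_infima zeta nu -> finite_infima zeta (mu `&` nu)%O.
Proof.
move=> [F [Fz Ff [Fl Fg]]] [G [Gz Gf [Gl Gg]]]; exists (F `|` G); split.
- by move=> k [/Fz|/Gz].
- by rewrite finite_setU.
- split=> [k [Fk|Gk]|k kb].
  + exact: le_trans (leIl _ _) (Fl _ Fk).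
  + exact: le_trans (leIr _ _) (Gl _ Gk).
  + by rewrite lexI Fg ?Gg // => h hh; apply: kb; [right|left].
Qed.

Lemma generated_meet zeta mu nu : generated_ltopology zeta mu ->
  generated_ltopology zeta nu -> generated_ltopology zeta (mu `&` nu)%O.
Proof.
move=> [S [Sz Smu]] [T [Tz Tnu]].
exists [set k | exists2 s, S s & exists2 t, T t & k = (s `&` t)%O]; split.
  by move=> _ [s Ss [t Tt ->]]; apply: finite_infima_meet; [exact: Sz|exact: Tz].
split=> [_ [s Ss [t Tt ->]]|g gub].
  by apply: leI2; [have [+ _] := Smu; apply|have [+ _] := Tnu; apply].
have [_ +] := fct_meet_supremums mu Tnu; apply=> _ [t Tt <-].
rewrite meetC; have [_ +] := fct_meet_supremums t Smu; apply=> _ [s Ss <-].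
by rewrite meetC; apply: gub; exists s => //; exists t.
Qed.

Lemma generated_is_ltopology zeta : is_ltopology (generated_ltopology zeta).
Proof.
split=> [S mu Sz [ub lub]|F mu Fz /finite_seqP[s Fs]].
  exists [set nu | finite_infima zeta nu /\ (nu <= mu)%O]; split.
    by move=> nu [].
  split=> [nu []//|g gub]; apply: lub => k Sk.
  have [T [Tz [Tu +]]] := Sz _ Sk; apply=> t Tt; apply: gub; split.
    exact: Tz.
  exact: le_trans (Tu _ Tt) (ub _ Sk).
rewrite {}Fs in Fz *; elim: s mu Fz => [|k s IH] mu Fz Hmu.
  exists [set mu]; split; last by rewrite supremums1.
  move=> _ ->; exists set0; split=> //.
  rewrite (_ : set0 = [set` [::]]) //.
  by apply/seteqP; split.
have [nu Hnu] := fct_infimums_ex [set` s].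
have E : [set` k :: s] = k |` [set` s].
  apply/seteqP; split=> h /=; rewrite in_cons; last first.
    by case=> [->|->]; rewrite ?eqxx ?orbT.
  by case/orP=> [/eqP|]; [left|right].
rewrite E in Hmu.
rewrite (is_subset1_infimums Hmu (infimums_meet k Hnu)).
apply: generated_meet; first by apply: Fz; rewrite /= mem_head.
by apply: IH => // h hs; apply: Fz; rewrite /= in_cons hs orbT.
Qed.

End GeneratedTopology.

Record ltop_space (d : Order.disp_t) (L : frameType d) := LTopSpace {
  carrier :> Type ;
  opens : set (carrier -> L) ;
  opensP : is_ltopology opens }.

Definition lcontinuous (d : Order.disp_t) (L : frameType d)
    (X Y : ltop_space L) (f : X -> Y) : Prop :=
  forall nu : Y -> L, opens nu -> opens (nu \o f).

Definition sierpinski (d : Order.disp_t) (L : frameType d) : ltop_space L :=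
  LTopSpace (generated_is_ltopology [set (idfun : L -> L)]).

Definition T0_space (d : Order.disp_t) (L : frameType d)
    (X : ltop_space L) : Prop :=
  forall x y : X, x <> y -> exists mu : X -> L, opens mu /\ mu x <> mu y.

Record category := Category {
  obj : Type ;
  hom : obj -> obj -> Type ;
  cat_id : forall X, hom X X ;
  cat_comp : forall X Y Z, hom Y Z -> hom X Y -> hom X Z ;
  cat_compA : forall X Y Z W (h : hom Z W) (g : hom Y Z) (f : hom X Y),
    cat_comp h (cat_comp g f) = cat_comp (cat_comp h g) f ;
  cat_comp_idl : forall X Y (f : hom X Y), cat_comp (cat_id Y) f = f ;
  cat_comp_idr : forall X Y (f : hom X Y), cat_comp f (cat_id X) = f }.

Section CategoryNotions.
Variable C : category.

Definition epi (X Y : obj C) (e : hom X Y) : Prop :=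
  forall (Z : obj C) (g h : hom Y Z), cat_comp g e = cat_comp h e -> g = h.

Definition isomorphic (X Y : obj C) : Prop :=
  exists (f : hom X Y) (g : hom Y X), cat_comp g f = cat_id X /\ cat_comp f g = cat_id Y.

(* Full replete subcategories of [C] are represented by their classes of
   objects. These are of type [obj C -> Prop] and not [set (obj C)], which would
   bound the universe of [obj C] by that of [set]. *)
Definition replete (R : obj C -> Prop) : Prop :=
  forall X Y : obj C, isomorphic X Y -> R X -> R Y.

Definition epireflective (R : obj C -> Prop) : Prop :=
  replete R /\
  forall X : obj C, exists (RX : obj C) (r : hom X RX),
    [/\ R RX, epi r &
        forall (Y : obj C) (f : hom X Y), R Y ->
          exists! fstar : hom RX Y, f = cat_comp fstar r].

Definition epireflective_hull (E : obj C) (H : obj C -> Prop) : Prop :=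
  [/\ epireflective H, H E &
      forall R : obj C -> Prop, epireflective R -> R E -> forall X, H X -> R X].

End CategoryNotions.

Section LTopCategory.
Variables (d : Order.disp_t) (L : frameType d).

Definition ltop_hom (X Y : ltop_space L) : Type := {f : X -> Y | lcontinuous f}.

Lemma ltop_hom_eq (X Y : ltop_space L) (f g : ltop_hom X Y) :
  proj1_sig f = proj1_sig g -> f = g.
Proof.
case: f g => [f cf] [g cg] /= fg; rewrite -fg in cg *.
by rewrite (Prop_irrelevance cf cg).
Qed.

Lemma lcontinuous_id (X : ltop_space L) : lcontinuous (@idfun X).
Proof. by []. Qed.

Lemma lcontinuous_comp (X Y Z : ltop_space L) (g : Y -> Z) (f : X -> Y) :
  lcontinuous g -> lcontinuous f -> lcontinuous (g \o f).
Proof. by move=> cg cf nu /cg /cf. Qed.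

Definition ltop_id (X : ltop_space L) : ltop_hom X X :=
  exist _ idfun (@lcontinuous_id X).

Definition ltop_comp (X Y Z : ltop_space L)
    (g : ltop_hom Y Z) (f : ltop_hom X Y) : ltop_hom X Z :=
  exist _ (proj1_sig g \o proj1_sig f)
    (lcontinuous_comp (proj2_sig g) (proj2_sig f)).

Lemma ltop_compA (X Y Z W : ltop_space L) (h : ltop_hom Z W)
    (g : ltop_hom Y Z) (f : ltop_hom X Y) :
  ltop_comp h (ltop_comp g f) = ltop_comp (ltop_comp h g) f.
Proof. exact: ltop_hom_eq. Qed.

Lemma ltop_comp_idl (X Y : ltop_space L) (f : ltop_hom X Y) :
  ltop_comp (ltop_id Y) f = f.
Proof. exact: ltop_hom_eq. Qed.

Lemma ltop_comp_idr (X Y : ltop_space L) (f : ltop_hom X Y) :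
  ltop_comp f (ltop_id X) = f.
Proof. exact: ltop_hom_eq. Qed.

Definition LTop : category :=
  Category ltop_compA ltop_comp_idl ltop_comp_idr.

Definition LTop0 : obj LTop -> Prop := @T0_space d L.

End LTopCategory.

Arguments LTop0 {d} L _.

(* Main.v *)
Require Import Defs.
From mathcomp Require Import all_boot all_order.
From mathcomp Require Import boolp classical_sets functions cardinality.
Set Implicit Arguments.
Unset Strict Implicit.
Unset Printing Implicit Defensive.
Import Order.LTheory.
Local Open Scope classical_set_scope.

(** The [T0]-reflection of [X] is its quotient by topological
    indistinguishability, with the final topology. Conversely, let [R] be
    epireflective and contain the Sierpinski space, and let [X] be [T0] with
    reflection [r : X -> RX]. The open sets of [X] are the continuous maps
    into the Sierpinski space, hence they all factor through [r] as open sets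
    of [RX]; so [r] is injective and initial. Epimorphisms of [LTop] are
    surjective, because every map into an indiscrete space is continuous.
    Thus [r] is an isomorphism. *)

Section PointwiseBounds.
Variables (d : Order.disp_t) (L : frameType d).

(** Pointwise infima exist because [L] is complete, and infima are unique, so any infimum is the
    pointwise one. *)
Lemma fct_infimumsP (X : Type) (S : set (X -> L)) (mu : X -> L) :
  infimums S mu <-> forall x, infimums [set nu x | nu in S] (mu x).
Proof.
have pointwise (s : X -> L) :
    (forall x, infimums [set nu x | nu in S] (s x)) -> infimums S s.
  move=> Hs; split=> [nu Snu|g glb]; apply/lefP => y.
    by have [+ _] := Hs y; apply; exists nu.
  have [_ +] := Hs y; apply=> _ [nu Snu <-].
  by have /lefP := glb _ Snu; apply.
split=> [Smu|]; last exact: pointwise.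
have [s Hs] := choice (fun y => frame_inf [set nu y | nu in S]).
by rewrite (is_subset1_infimums Smu (pointwise _ Hs)).
Qed.

Lemma ev_precomp (X Y : Type) (f : X -> Y) (S : set (Y -> L)) (x : X) :
  [set nu x | nu in [set nu \o f | nu in S]] = [set nu (f x) | nu in S].
Proof. by rewrite image_comp. Qed.

Lemma supremums_precomp (X Y : Type) (f : X -> Y) (S : set (Y -> L))
    (mu : Y -> L) :
  supremums S mu -> supremums [set nu \o f | nu in S] (mu \o f).
Proof.
move=> /fct_supremumsP H; apply/fct_supremumsP => x.
by rewrite ev_precomp; exact: H.
Qed.

Lemma infimums_precomp (X Y : Type) (f : X -> Y) (S : set (Y -> L))
    (mu : Y -> L) :
  infimums S mu -> infimums [set nu \o f | nu in S] (mu \o f).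
Proof.
move=> /fct_infimumsP H; apply/fct_infimumsP => x.
by rewrite ev_precomp; exact: H.
Qed.

End PointwiseBounds.

Section LTopologies.
Variables (d : Order.disp_t) (L : frameType d).
Implicit Types X Y : ltop_space L.

(** Suprema and infima of maps are pointwise, so precomposition with [f] preserves them. *)
Lemma final_is_ltopology X (T : Type) (f : X -> T) :
  is_ltopology [set nu : T -> L | opens (nu \o f)].
Proof.
have [opens_sup opens_inf] := opensP X.
split=> [S mu So /(supremums_precomp f)|F mu Fo Ffin /(infimums_precomp f)].
  by apply: opens_sup => _ [nu /So ? <-].
by apply: opens_inf; [move=> _ [nu /Fo ? <-]|exact: finite_image].
Qed.

Definition final_space X (T : Type) (f : X -> T) : ltop_space L :=
  LTopSpace (final_is_ltopology f).

Lemma sub_generated (T : Type) (zeta : set (T -> L)) :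
  zeta `<=` generated_ltopology zeta.
Proof.
move=> mu zmu; exists [set mu]; split; last by rewrite supremums1.
move=> _ ->; exists [set mu]; split; [by move=> _ ->|exact: finite_set1|].
by rewrite infimums1.
Qed.

Lemma generated_sub (T : Type) (zeta tau : set (T -> L)) :
  is_ltopology tau -> zeta `<=` tau -> generated_ltopology zeta `<=` tau.
Proof.
move=> [tau_sup tau_inf] zt mu [S [Sz]]; apply: tau_sup => nu /Sz [F [Fz]].
by apply: tau_inf => k /Fz /zt.
Qed.

(** The final topology along [mu] contains [idfun], hence the whole topology that [idfun]
    generates. *)
Lemma open_continuous_sierpinski X (mu : X -> L) :
  opens mu -> @lcontinuous d L X (sierpinski L) mu.
Proof.
by move=> omu; apply: (generated_sub (final_is_ltopology mu)) => _ ->.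
Qed.

Lemma continuous_sierpinski_open X (mu : X -> L) :
  @lcontinuous d L X (sierpinski L) mu -> opens mu.
Proof. by move=> cmu; exact/(cmu idfun)/sub_generated. Qed.

Lemma sierpinski_T0 : T0_space (sierpinski L).
Proof. by move=> x y xy; exists idfun; split=> //; exact: sub_generated. Qed.

(** Generating from [set0] gives the least [L]-topology, which every final topology contains. *)
Definition indiscrete_space (T : Type) : ltop_space L :=
  LTopSpace (generated_is_ltopology (set0 : set (T -> L))).

Lemma continuous_indiscrete X (T : Type) (f : X -> T) :
  @lcontinuous d L X (indiscrete_space T) f.
Proof. exact: (generated_sub (final_is_ltopology f) (@sub0set _ _)). Qed.

Lemma epi_surjective X Y (e : ltop_hom X Y) :
  @epi (LTop L) X Y e -> forall y, exists x, proj1_sig e x = y.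
Proof.
move=> epi_e.
(* Membership in the image of [e] and the constant [True] agree after composition with [e]. *)
pose Z := indiscrete_space Prop.
pose g : ltop_hom Y Z :=
  exist _ _ (continuous_indiscrete (fun y => exists x, proj1_sig e x = y)).
pose h : ltop_hom Y Z := exist _ _ (continuous_indiscrete (fun=> True)).
have gh : g = h.
  apply: (epi_e Z); apply: ltop_hom_eq; apply/funext => x /=.
  by apply/propext; split=> // _; exists x.
by move=> y; have /(congr1 (fun k => proj1_sig k y)) /= -> := gh.
Qed.

Lemma surjective_epi X Y (e : ltop_hom X Y) :
  (forall y, exists x, proj1_sig e x = y) -> @epi (LTop L) X Y e.
Proof.
move=> surj Z g h /(congr1 (@proj1_sig _ _)) /= gh.
apply: ltop_hom_eq; apply/funext => y; have [x <-] := surj y.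
exact: (congr1 (@^~ x) gh).
Qed.

Lemma T0_replete : @replete (LTop L) (LTop0 L).
Proof.
move=> X Y [f [g [_ /(congr1 (@proj1_sig _ _)) /= fg]]] T0X x y xy.
have [|mu [omu neq]] := T0X (proj1_sig g x) (proj1_sig g y).
  move=> gxy; apply: xy; rewrite -[x](congr1 (@^~ x) fg) /= gxy.
  exact: (congr1 (@^~ y) fg).
by exists (mu \o proj1_sig g); split=> //; exact: (proj2_sig g).
Qed.

End LTopologies.

Section T0Reflection.
Variables (d : Order.disp_t) (L : frameType d) (X : ltop_space L).

Definition indist (x : X) : X -> Prop :=
  fun y => forall mu : X -> L, opens mu -> mu x = mu y.

(** Points are the indistinguishability classes themselves, as predicates, so that extensionality
    identifies the classes of indistinguishable points. *)
Definition T0_quot : Type := {c : X -> Prop | exists x, c = indist x}.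

Definition T0_pi (x : X) : T0_quot := exist _ (indist x) (ex_intro _ x erefl).

Definition T0_repr (c : T0_quot) : X := sval (cid (proj2_sig c)).

Lemma T0_reprK (c : T0_quot) : T0_pi (T0_repr c) = c.
Proof.
by case: c => c cP; apply: eq_exist; exact/esym/(svalP (cid cP)).
Qed.

Lemma eq_T0_pi (x y : X) : T0_pi x = T0_pi y <-> indist x y.
Proof.
split=> [/(congr1 (@proj1_sig _ _)) /= -> //|xy].
apply: eq_exist; apply/funext => z; apply/propext; split=> H mu omu.
  by rewrite -xy ?H.
by rewrite xy ?H.
Qed.

Lemma indist_repr (x : X) : indist (T0_repr (T0_pi x)) x.
Proof. exact/eq_T0_pi/T0_reprK. Qed.

Definition T0_refl : ltop_space L := final_space T0_pi.

Definition T0_refl_map : ltop_hom X T0_refl :=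
  exist (@lcontinuous d L X T0_refl) T0_pi (fun _ => id).

Lemma T0_refl_T0 : T0_space T0_refl.
Proof.
move=> x y; apply: contra_notP => /forallNP H.
rewrite -(T0_reprK x) -(T0_reprK y); apply/eq_T0_pi => mu omu.
have [//|neq] := pselect (mu (T0_repr x) = mu (T0_repr y)).
(* An open [mu] is constant on classes, so it descends to the quotient as [mu \o T0_repr]. *)
case: (H (mu \o T0_repr)); split=> //=.
rewrite (_ : _ \o _ = mu) //; apply/funext => z /=; exact: indist_repr.
Qed.

Lemma T0_refl_surj (c : T0_refl) : exists x, proj1_sig T0_refl_map x = c.
Proof. by exists (T0_repr c); exact: T0_reprK. Qed.

Lemma T0_refl_factor (Y : ltop_space L) (f : ltop_hom X Y) : T0_space Y ->
  exists g : ltop_hom T0_refl Y, f = ltop_comp g T0_refl_map.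
Proof.
move=> T0Y.
have fK : (proj1_sig f \o T0_repr) \o T0_pi = proj1_sig f.
  (* An open set of [Y] separating the two values would pull back along [f] to one separating [x]
     from its representative. *)
  apply/funext => x /=; apply: contrapT => /T0Y [mu [omu]]; apply.
  exact: (@indist_repr x _ (proj2_sig f mu omu)).
have cg : @lcontinuous d L T0_refl Y (proj1_sig f \o T0_repr).
  by move=> nu onu; rewrite /= -compA fK; exact: (proj2_sig f).
by exists (exist _ _ cg); apply: ltop_hom_eq; rewrite -[LHS]fK.
Qed.

End T0Reflection.

Lemma T0_epireflective (d : Order.disp_t) (L : frameType d) :
  @epireflective (LTop L) (LTop0 L).
Proof.
split=> [|X]; first exact: T0_replete.
have epi_r := surjective_epi (@T0_refl_surj d L X).
exists (T0_refl X), (T0_refl_map X); split=> // [|Y f T0Y].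
  exact: T0_refl_T0.
have [g fg] := T0_refl_factor f T0Y.
(* Uniqueness of the factor comes from [T0_refl_map] being epi. *)
by exists g; split=> // h fh; apply: epi_r; rewrite -fh -[LHS]fg.
Qed.

Lemma sierpinski_factor_iso (d : Order.disp_t) (L : frameType d)
    (X Y : ltop_space L) (r : ltop_hom X Y) :
  T0_space X -> @epi (LTop L) X Y r ->
  (forall f : ltop_hom X (sierpinski L),
     exists g : ltop_hom Y (sierpinski L), f = ltop_comp g r) ->
  @isomorphic (LTop L) Y X.
Proof.
move=> T0X /epi_surjective r_surj factor.
have open_factor (mu : X -> L) : opens mu ->
    exists2 nu : Y -> L, opens nu & mu = nu \o proj1_sig r.
  move=> /open_continuous_sierpinski cmu; have [g gE] := factor (exist _ mu cmu).
  exists (proj1_sig g); last exact: (congr1 (@proj1_sig _ _) gE).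
  exact: continuous_sierpinski_open (proj2_sig g).
have [s sK] := choice r_surj.
(* An open set separating [s (r x)] from [x] has the form [nu \o r], but [r] sends both points to
   [r x]. *)
have rK x : s (proj1_sig r x) = x.
  apply: contrapT => /T0X [mu [/open_factor [nu _ ->]]]; apply=> /=.
  by rewrite sK.
(* Initiality of [r] makes its section continuous: [nu \o r \o s = nu]. *)
have cs : lcontinuous s.
  move=> _ /open_factor [nu onu ->].
  by rewrite (_ : _ \o s = nu) //; apply/funext => y /=; rewrite sK.
exists (exist _ s cs), r; split; apply: ltop_hom_eq; apply/funext => z /=.
  exact: sK.
exact: rK.
Qed.

Theorem theorem5p4 (d : Order.disp_t) (L : frameType d) :
  @epireflective_hull (LTop L) (sierpinski L) (LTop0 L).
Proof.
split; [exact: T0_epireflective|exact: sierpinski_T0|].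
move=> R [R_replete R_refl] R_sierp X T0X.
have [RX [r [R_RX epi_r univ]]] := R_refl X.
apply: R_replete R_RX; apply: (sierpinski_factor_iso T0X epi_r) => f.
by have [g [fg _]] := univ _ f R_sierp; exists g.
Qed.
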